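(* Let $G$ be a connected simply connected nilpotent Lie group with Lie algebra $\mathfrak g$, let $\Xi:=G\times\mathfrak g^\sharp$, let $\omega\in\mathcal S(G)$ with $\|\omega\|_{L^2(G)}=1$, and let $f\in L^\infty(\Xi)$. Define the operator $\mathsf{Tp}_\omega(f):=\mathscr B_\omega\circ\mathsf{Ber}_\omega(f)\circ\mathscr B_\omega^\dagger$ in $L^2(\Xi)$. Then $$\mathsf{Tp}_\omega(f)=\mathscr P_\omega\circ\mathsf{Mult}(f)\circ\mathscr P_\omega ,$$ where $\mathsf{Mult}(f)$ is the operator of pointwise multiplication by $f$ in $L^2(\Xi)$.
   Context: Scalar products are linear in the first variable. $\mathfrak g^\sharp$ is the dual of $\mathfrak g$, with pairing $\langle X\mid\xi\rangle:=\xi(X)$; $\exp:\mathfrak g\to G$ is a diffeomorphism with inverse $\log$. $dX$ is a Lebesgue measure on $\mathfrak g$, $dx$ is the Haar measure on $G$ that is its image under $\exp$, and $d\xi$ is the Lebesgue measure on $\mathfrak g^\sharp$ normalized so that $(\mathcal F h)(\xi)=\int_{\mathfrak g}e^{-i\langle X\mid\xi\rangle}h(X)\,dX$ extends to a unitary map $L^2(\mathfrak g)\to L^2(\mathfrak g^\sharp)$. $\Xi=G\times\mathfrak g^\sharp$ carries the product measure $dx\,d\xi$. $\mathcal S(G)=\{u:\ u\circ\exp\in\mathcal S(\mathfrak g)\}$ is the Schwartz space. For $(z,\zeta)\in\Xi$ the unitary operator $\mathsf W(z,\zeta)$ in $L^2(G)$ is $[\mathsf W(z,\zeta)u](x):=e^{i\langle\log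 x\mid\zeta\rangle}u(z^{-1}x)$. For $u,v\in L^2(G)$ the Fourier-Wigner transform is $\mathscr W_{u,v}(z,\zeta):=\langle \mathsf W(z,\zeta)u,v\rangle$. The generalized Bargmann transformation is the isometry $\mathscr B_\omega:L^2(G)\to L^2(\Xi)$, $\mathscr B_\omega(u):=\mathscr W_{u,\omega}$; $\mathscr B_\omega^\dagger:L^2(\Xi)\to L^2(G)$ is its Hilbert space adjoint, and $\mathscr P_\omega:=\mathscr B_\omega\mathscr B_\omega^\dagger$ is its final projection. The Berezin operator $\mathsf{Ber}_\omega(f)$ is the bounded operator in $L^2(G)$ defined weakly by $$\langle\mathsf{Ber}_\omega(f)u,v\rangle:=\int_\Xi f(x,\xi)\,\mathscr W_{u,\omega}(x,\xi)\,\overline{\mathscr W_{v,\omega}(x,\xi)}\,dx\,d\xi,\qquad u,v\in L^2(G).$$ *)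

(* Defs.v *)
From HB Require Import structures.
From mathcomp Require Import all_boot all_order all_algebra.
From mathcomp Require Import generic_quotient.
From mathcomp Require Import all_classical all_reals all_analysis.
From mathcomp.real_closed Require Import complex.

Set Implicit Arguments.
Unset Strict Implicit.
Unset Printing Implicit Defensive.

Import Order.TTheory GRing.Theory Num.Theory.
Import numFieldNormedType.Exports.

Local Open Scope classical_set_scope.
Local Open Scope ring_scope.
Local Open Scope complex_scope.
Local Open Scope quotient_scope.

Section Smooth.
Context {R : realType} {V W : normedModType R}.
Implicit Types (f : V -> W) (U : set V).

Definition iter_derive (vs : seq V) f : V -> W :=
  foldr (fun v g => 'D_v g) f vs.

(* Meaningful for open [U], where derivatives at points of [U] do not depend on
   the values of [f] outside [U]; [f] is then C^oo on [U] as soon as all its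
   iterated directional derivatives exist and are continuous on [U]. *)
Definition smooth_on U f : Prop :=
  forall (vs : seq V) (x : V), U x ->
    {for x, continuous (iter_derive vs f)} /\
    forall v : V, derivable (iter_derive vs f) x v.

End Smooth.

#[short(type="ptopGroupType")]
HB.structure Definition PTopGroup := {G of PointedTopological G & Group G}.

(* A coordinate patch of [G] with its inverse; [chart_param] is irrelevant
   outside [chart_coord @` chart_dom]. *)
Record chart (R : realType) (n : nat) (G : Type) := Chart {
  chart_dom : set G;
  chart_coord : G -> 'rV[R]_n;
  chart_param : 'rV[R]_n -> G }.

Section LieGroup.
Context {R : realType} {n : nat} {G : ptopGroupType}.
Implicit Types (A : set (chart R n G)) (a b c : chart R n G).

Definition chart_image c : set 'rV[R]_n := chart_coord c @` chart_dom c.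

Record is_chart c : Prop := IsChart {
  chart_dom_open : open (chart_dom c);
  chart_image_open : open (chart_image c);
  chart_coordK : forall x, chart_dom c x -> chart_param c (chart_coord c x) = x;
  chart_coord_cont : forall x, chart_dom c x ->
    {for x, continuous (chart_coord c)};
  chart_param_cont : forall v, chart_image c v ->
    {for v, continuous (chart_param c)} }.

Record is_smooth_atlas A : Prop := IsSmoothAtlas {
  atlas_charts : forall c, A c -> is_chart c;
  atlas_cover : forall x : G, exists2 c, A c & chart_dom c x;
  atlas_compatible : forall a b, A a -> A b ->
    smooth_on (chart_coord a @` (chart_dom a `&` chart_dom b))
      (chart_coord b \o chart_param a) }.

Record is_lie_group A : Prop := IsLieGroup {
  lie_hausdorff : hausdorff_space G;
  lie_second_countable : @second_countable G;
  lie_atlas : is_smooth_atlas A;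
  lie_mul_cont : continuous (fun p : G * G => (p.1 * p.2)%g : G);
  lie_mul_smooth : forall a b c, A a -> A b -> A c ->
    smooth_on
      [set v : 'rV[R]_n * 'rV[R]_n |
        [/\ chart_image a v.1, chart_image b v.2 &
            chart_dom c (chart_param a v.1 * chart_param b v.2)%g]]
      (fun v => chart_coord c (chart_param a v.1 * chart_param b v.2)%g);
  lie_inv_cont : continuous (fun x : G => (x^-1)%g : G);
  lie_inv_smooth : forall a c, A a -> A c ->
    smooth_on
      [set v | chart_image a v /\ chart_dom c (chart_param a v)^-1%g]
      (fun v => chart_coord c (chart_param a v)^-1%g) }.

(* [exp] is the exponential map of [G], where R^n is identified with the
   tangent space at 1: [t |-> exp (t X)] is the one-parameter subgroup whose
   velocity at 1 corresponds to [X], and this correspondence is a linear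
   isomorphism (read in any chart around 1). *)
Record is_exponential_map A (exp : 'rV[R]_n -> G) : Prop := IsExponentialMap {
  exp_one_parameter : forall (X : 'rV[R]_n) (s t : R),
    exp ((s + t) *: X) = (exp (s *: X) * exp (t *: X))%g;
  exp_velocity : forall c, A c -> chart_dom c 1%g ->
    exists2 L : 'M[R]_n, L \in unitmx &
      forall X : 'rV[R]_n,
        is_derive (0 : R^o) 1 (fun t : R^o => chart_coord c (exp (t *: X)))
          (X *m L) }.

Record is_diffeomorphism A (exp : 'rV[R]_n -> G) (log : G -> 'rV[R]_n) : Prop :=
  IsDiffeomorphism {
  diffeo_expK : cancel exp log;
  diffeo_logK : cancel log exp;
  diffeo_exp_cont : continuous exp;
  diffeo_log_cont : continuous log;
  diffeo_exp_smooth : forall c, A c ->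
    smooth_on (exp @^-1` chart_dom c) (chart_coord c \o exp);
  diffeo_log_smooth : forall c, A c ->
    smooth_on (chart_image c) (log \o chart_param c) }.

(* [br] is the Lie bracket of the Lie algebra of [G]; the last clause is
   [X, Y] = d/ds Ad(exp (s X)) Y at s = 0, with
   Ad(x) Y = log (x exp(Y) x^-1). *)
Record is_lie_bracket (exp : 'rV[R]_n -> G) (log : G -> 'rV[R]_n)
    (br : 'rV[R]_n -> 'rV[R]_n -> 'rV[R]_n) : Prop := IsLieBracket {
  bracket_linearl : forall Y (a : R) X X',
    br (a *: X + X') Y = a *: br X Y + br X' Y;
  bracket_linearr : forall X (a : R) Y Y',
    br X (a *: Y + Y') = a *: br X Y + br X Y';
  bracket_alternating : forall X, br X X = 0;
  bracket_jacobi : forall X Y Z,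
    br X (br Y Z) + br Y (br Z X) + br Z (br X Y) = 0;
  bracket_ad : forall X Y,
    is_derive (0 : R^o) 1
      (fun s : R^o => log (exp (s *: X) * exp Y * (exp (s *: X))^-1)%g)
      (br X Y) }.

End LieGroup.

Section GroupProperties.
Context {G : ptopGroupType}.

(* Every loop is null-homotopic relative to its base point. *)
Definition simply_connected (R : realType) : Prop :=
  forall gamma : R -> G,
    {within `[0, 1], continuous gamma} -> gamma 0 = gamma 1 ->
    exists H : R * R -> G,
      [/\ {within `[0, 1] `*` `[0, 1], continuous H},
          forall t, t \in `[0, 1] -> H (0, t) = gamma t,
          forall t, t \in `[0, 1] -> H (1, t) = gamma 0 &
          forall s, s \in `[0, 1] -> H (s, 0) = gamma 0 /\ H (s, 1) = gamma 0].

Definition is_subgroup (H : set G) : Prop :=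
  [/\ H 1%g, forall x y, H x -> H y -> H (x * y)%g &
      forall x, H x -> H (x^-1)%g].

Fixpoint lower_central (k : nat) : set G :=
  if k is k'.+1 then
    smallest is_subgroup
      [set g | exists x y : G, lower_central k' x /\ g = [~ x, y]%g]
  else setT.

Definition nilpotent_group : Prop := exists k, lower_central k = [set 1%g].

End GroupProperties.

Arguments simply_connected G R : clear implicits.
Arguments nilpotent_group G : clear implicits.

Notation borel T := (@g_sigma_algebraType T open).

Section Measures.
Context {R : realType}.
Local Open Scope ereal_scope.

(* A Lebesgue measure on a space of matrices (in particular on R^n): the
   measures of boxes are a constant multiple of their volumes. *)
Definition is_lebesgue_measure (m n : nat)
    (mu : set (borel 'M[R]_(m, n)) -> \bar R) : Prop :=
  exists2 c : R, (0 < c)%R &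
    forall a b : 'M[R]_(m, n), (forall i j, (a i j <= b i j)%R) ->
      mu [set X : 'M[R]_(m, n) | forall i j, (a i j <= X i j <= b i j)%R] =
      (c * \prod_i \prod_j (b i j - a i j))%R%:E.

Record is_haar_measure (G : ptopGroupType)
    (mu : set (borel G) -> \bar R) : Prop := IsHaarMeasure {
  haar_left_invariant : forall (z : G) (B : set (borel G)),
    measurable B -> mu [set (z * x)%g | x in B] = mu B;
  haar_compact_finite : forall K : set G, compact K -> mu K < +oo;
  haar_neq0 : mu setT != 0 }.

End Measures.

Section Complex.
Context {R : realType}.

Local Notation re := (@complex.Re R).
Local Notation im := (@complex.Im R).

Definition expi (t : R) : R[i] := cos t +i* sin t.

Definition sqmod (z : R[i]) : R := re z ^+ 2 + im z ^+ 2.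

Section Integration.
Context {d : measure_display} {T : measurableType d}.
Variable mu : {measure set T -> \bar R}.
Implicit Types f g : T -> R[i].

Definition cmeasurable f : Prop :=
  measurable_fun setT (re \o f) /\ measurable_fun setT (im \o f).

Definition cintegrable f : Prop :=
  mu.-integrable setT (EFin \o re \o f) /\
  mu.-integrable setT (EFin \o im \o f).

Definition cintegral f : R[i] :=
  (\int[mu]_x re (f x))%R +i* (\int[mu]_x im (f x))%R.

Definition square_integrable f : Prop :=
  cmeasurable f /\ (\int[mu]_x (sqmod (f x))%:E < +oo)%E.

Definition essentially_bounded f : Prop :=
  cmeasurable f /\ exists M : R, {ae mu, forall x, sqmod (f x) <= M ^+ 2}.

Definition inner f g : R[i] := cintegral (fun x => f x * (g x)^*).

Definition l2norm f : R := Num.sqrt (\int[mu]_x sqmod (f x))%R.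

Record l2fun := L2Fun { l2fun_val : T -> R[i]; _ : square_integrable l2fun_val }.

HB.instance Definition _ := gen_eqMixin l2fun.
HB.instance Definition _ := gen_choiceMixin l2fun.

Definition l2fun_eq (f g : l2fun) : bool :=
  `[< {ae mu, forall x, l2fun_val f x = l2fun_val g x} >].

Lemma l2fun_eq_refl : reflexive l2fun_eq.
Proof. by move=> f; apply/asboolP; apply: aeW. Qed.

Lemma l2fun_eq_sym : symmetric l2fun_eq.
Proof.
by move=> f g; apply/idP/idP => /asboolP fg; apply/asboolP; apply: filterS fg.
Qed.

Lemma l2fun_eq_trans : transitive l2fun_eq.
Proof.
move=> g f h /asboolP fg /asboolP gh; apply/asboolP.
by apply: filterS2 fg gh => x -> ->.
Qed.

Canonical l2fun_eq_equiv :=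
  EquivRel l2fun_eq l2fun_eq_refl l2fun_eq_sym l2fun_eq_trans.

Definition L2 : Type := {eq_quot l2fun_eq}.
HB.instance Definition _ := Choice.on L2.
HB.instance Definition _ := EqQuotient.on L2.

Definition L2_val (u : L2) : T -> R[i] := l2fun_val (repr u).

Lemma square_integrable0 : square_integrable (fun=> 0).
Proof.
split; first by split; exact: measurable_cst.
by under eq_integral do rewrite /sqmod /= !expr0n /= addr0; rewrite integral0.
Qed.

Definition L2_zero : L2 := \pi_L2%qT (L2Fun square_integrable0).

(* The class of [f], for square-integrable [f]. *)
Definition L2_class f : L2 :=
  match pselect (square_integrable f) with
  | left hf => \pi_L2%qT (L2Fun hf)
  | right _ => L2_zero
  end.

End Integration.

Coercion L2_val : L2 >-> Funclass.

Section Operators.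
Context {d1 d2 : measure_display}.
Context {T1 : measurableType d1} {T2 : measurableType d2}.
Context {mu : {measure set T1 -> \bar R}} {nu : {measure set T2 -> \bar R}}.

(* A surjective map preserving the scalar product is automatically linear. *)
Definition is_unitary (U : L2 mu -> L2 nu) : Prop :=
  (forall u v : L2 mu, inner nu (U u) (U v) = inner mu u v) /\
  (forall F : L2 nu, exists u : L2 mu, U u = F).

(* [adjoint B F] is the Riesz vector of u |-> <B u, F>: it is the unique [w]
   such that <u, w> = <B u, F> for all [u]. *)
Definition adjoint (B : L2 mu -> L2 nu) (F : L2 nu) : L2 mu :=
  xget (L2_zero mu)
    [set w : L2 mu | forall u : L2 mu, inner mu u w = inner nu (B u) F].

End Operators.

Definition mult_op {d : measure_display} {T : measurableType d}
    (mu : {measure set T -> \bar R}) (f : T -> R[i]) (F : L2 mu) : L2 mu :=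
  L2_class mu (fun p => f p * F p).

(* The linear forms on row vectors are represented by column vectors. *)
Definition pairing {n : nat} (X : 'rV[R]_n) (xi : 'cV[R]_n) : R :=
  (X *m xi) ord0 ord0.

Section Fourier.
Context {n : nat}.
Variable dX : {measure set (borel 'rV[R]_n) -> \bar R}.
Variable dxi : {measure set (borel 'cV[R]_n) -> \bar R}.

Definition fourier (h : 'rV[R]_n -> R[i]) (xi : 'cV[R]_n) : R[i] :=
  cintegral dX (fun X => expi (- pairing X xi) * h X).

Definition fourier_normalized : Prop :=
  exists2 U : L2 dX -> L2 dxi, is_unitary U &
    forall h : borel 'rV[R]_n -> R[i],
      cintegrable dX h -> square_integrable dX h ->
      square_integrable dxi (fourier h) /\
      U (L2_class dX h) = L2_class dxi (fourier h).

End Fourier.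

Definition real_schwartz {V : normedModType R} (f : V -> R^o) : Prop :=
  smooth_on setT f /\
  forall (k : nat) (vs : seq V), exists M : R, forall X : V,
    (1 + `|X|) ^+ k * `|iter_derive vs f X| <= M.

Definition schwartz {V : normedModType R} (f : V -> R[i]) : Prop :=
  real_schwartz (re \o f) /\ real_schwartz (im \o f).

Section Wigner.
Context {n : nat} {G : ptopGroupType}.
Variable log : G -> 'rV[R]_n.
Variable dx : {sigma_finite_measure set (borel G) -> \bar R}.
Variable dxi : {sigma_finite_measure set (borel 'cV[R]_n) -> \bar R}.

Definition weyl (p : G * 'cV[R]_n) (u : G -> R[i]) (x : G) : R[i] :=
  expi (pairing (log x) p.2) * u (p.1^-1 * x)%g.

Definition fourier_wigner (u v : G -> R[i]) (p : G * 'cV[R]_n) : R[i] :=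
  inner dx (weyl p u) v.

Definition dXi : {measure set (borel G * borel 'cV[R]_n) -> \bar R} :=
  (dx \x dxi)%E.

Definition bargmann (omega : G -> R[i]) (u : L2 dx) : L2 dXi :=
  L2_class dXi (fourier_wigner u omega).

Definition bargmann_proj (omega : G -> R[i]) : L2 dXi -> L2 dXi :=
  bargmann omega \o adjoint (bargmann omega).

(* The form on the right-hand side is bounded in [u] and [v] for essentially
   bounded [f], so [w] exists and is unique. *)
Definition berezin (omega : G -> R[i]) (f : G * 'cV[R]_n -> R[i])
    (u : L2 dx) : L2 dx :=
  xget (L2_zero dx)
    [set w : L2 dx | forall v : L2 dx, inner dx w v =
      cintegral dXi (fun p =>
        f p * fourier_wigner u omega p * (fourier_wigner v omega p)^*)].

Definition toeplitz (omega : G -> R[i]) (f : G * 'cV[R]_n -> R[i]) :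
    L2 dXi -> L2 dXi :=
  bargmann omega \o berezin omega f \o adjoint (bargmann omega).

End Wigner.

End Complex.

(* Main.v *)
Require Import Defs.
From HB Require Import structures.
From mathcomp Require Import all_boot all_order all_algebra.
From mathcomp Require Import ring lra.
From mathcomp Require Import all_classical all_reals all_analysis.
From mathcomp Require Import measurable_realfun.
From mathcomp.real_closed Require Import complex.

(* Since <Ber(f) u, v> = <f W_u, W_v> and W_u represents B u, the operator
   Ber(f) equals B^* Mult(f) B, and the statement follows on composing with B on
   the left and B^* on the right.  What has to be proved is that W_u is square
   integrable, so that B u really is the class of W_u.  For fixed z, the
   function zeta |-> W_u(z, zeta) is the complex conjugate of a Fourier
   transform on the Lie algebra; Plancherel, Tonelli and the invariance of dx
   under left translations and inversion (exp turns inversion into X |-> - X)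
   give ||W_u|| = ||u|| ||omega||. *)

Set Implicit Arguments.
Unset Strict Implicit.
Unset Printing Implicit Defensive.

Import Order.TTheory GRing.Theory Num.Theory.
Import numFieldNormedType.Exports.

Local Open Scope classical_set_scope.
Local Open Scope ring_scope.
Local Open Scope complex_scope.

(** * Borel structures and continuous maps *)

Lemma bigcup_countable_measurable d (T : measurableType d) (I : choiceType)
    (D : set I) (F : I -> set T) :
  countable D -> (forall i, D i -> measurable (F i)) ->
  measurable (\bigcup_(i in D) F i).
Proof.
move=> cD mF; rewrite bigcup_set_type; apply: countable_bigcupT_measurable.
  by rewrite (eq_countable (card_setT D)).
by move=> i; apply: mF; exact: set_valP.
Qed.

Section Borel.
Context {S T U : ptopologicalType}.

Lemma continuous_borel (f : S -> T) :
  continuous f -> measurable_fun setT (f : borel S -> borel T).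
Proof.
move=> /continuousP cf.
apply: (@measurability _ _ (borel S) (borel T) _ _ open) => // _ [B oB <-].
by rewrite setTI; apply: sub_sigma_algebra; exact: cf.
Qed.

(** The target carries the measurable structure of [R] rather than [borel R], so measurability is
    tested on the open intervals that generate it. *)
Lemma continuous_borel_real (R : realType) (f : S -> R) :
  continuous f -> measurable_fun setT (f : borel S -> R).
Proof.
move=> /continuousP cf.
apply: (measurability _ (RGenOpens.measurableE R)).
move=> _ [_ [a [b ->] <-]]; rewrite setTI; apply: sub_sigma_algebra.
by apply: cf; exact: interval_open.
Qed.

(** The source carries the product of two Borel structures, in which an open set of [S * T] need not
    be measurable in general. Second countability repairs this: an open set is a countable union of
    open rectangles. *)
Lemma continuous_borel_prod (f : S * T -> U) :
  @second_countable S -> @second_countable T -> continuous f ->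
  measurable_fun setT (f : borel S * borel T -> borel U).
Proof.
move=> [BS cBS [oBS bBS]] [BT cBT [oBT bBT]] /continuousP cf.
apply: (@measurability _ _ (borel S * borel T)%type (borel U) _ _ open) => //.
move=> _ [C oC <-]; rewrite setTI.
set D := f @^-1` C; have oD : open D by exact: cf.
(* Basic open rectangles contained in [D]; there are countably many, since both bases are
   countable. *)
pose I := [set V : set S * set T | [/\ BS V.1, BT V.2 & V.1 `*` V.2 `<=` D]].
have -> : D = \bigcup_(V in I) (V.1 `*` V.2).
  apply/seteqP; split=> [[x y] Dxy|p [V [_ _ VD] Vp]]; last exact: VD.
  move: oD; rewrite openE => /(_ (x, y) Dxy) [[P Q] /= [Px Qy] PQD].
  have [V [BV Vx] VP] := bBS x P Px; have [W [BW Wy] WQ] := bBT y Q Qy.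
  exists (V, W) => //; split => //= -[a b] [/= Va Wb]; apply: PQD.
  by split => /=; [exact: VP|exact: WQ].
apply: bigcup_countable_measurable => [|V [BV BW _]].
  apply: sub_countable (countableX cBS cBT).
  by apply: subset_card_le => V [].
by apply: measurableX; apply: sub_sigma_algebra; [exact: oBS|exact: oBT].
Qed.
End Borel.

(** * Change of variables along measure-preserving maps *)

Section PreservedIntegral.
Context {d1 d2 : measure_display} {T1 : measurableType d1}
  {T2 : measurableType d2} {R : realType}.
Context (mu : {measure set T1 -> \bar R}) (nu : {measure set T2 -> \bar R}).
Context (phi : T1 -> T2) (mphi : measurable_fun setT phi).
Hypothesis nuE : forall B, measurable B -> nu B = pushforward mu phi B.

(** The nonnegative case is the pushforward formula. The general case applies it to the positive and
    negative parts, so that measurability of [g] suffices. *)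
Lemma integral_preserved (g : T2 -> \bar R) : measurable_fun setT g ->
  (\int[nu]_y g y = \int[mu]_x g (phi x))%E.
Proof.
move=> mg.
have H h : measurable_fun setT h -> (forall y, 0 <= h y)%E ->
    (\int[nu]_y h y = \int[mu]_x h (phi x))%E.
  move=> mh h0; rewrite -[RHS](ge0_integral_pushforward mphi mu measurableT mh)//.
  by apply: eq_measure_integral => B mB _; exact: nuE.
rewrite integralE [RHS](integralE _ _ (g \o phi)) (funepos_comp g phi)
  (funeneg_comp g phi); congr (_ - _)%E.
  by apply: (H (g^\+)%E); [exact: measurable_funepos|exact: funepos_ge0].
by apply: (H (g^\-)%E); [exact: measurable_funeneg|exact: funeneg_ge0].
Qed.

Lemma Rintegral_preserved (g : T2 -> R) : measurable_fun setT g ->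
  \int[nu]_y g y = \int[mu]_x g (phi x).
Proof.
by move=> mg; congr fine; rewrite integral_preserved//; exact/measurable_EFinP.
Qed.

End PreservedIntegral.

(** * Complex measurable functions and the squared modulus *)

Section ComplexMeasurable.
Context {R : realType} {d : measure_display} {T : measurableType d}.
Implicit Types f g : T -> R[i].

Lemma cmeasurable_comp {d' : measure_display} {T' : measurableType d'}
    (f : T -> R[i]) (phi : T' -> T) :
  cmeasurable f -> measurable_fun setT phi -> cmeasurable (f \o phi).
Proof.
move=> [mr mi] mphi; split.
  exact: (measurableT_comp mr mphi).
exact: (measurableT_comp mi mphi).
Qed.

Lemma cmeasurableM f g :
  cmeasurable f -> cmeasurable g -> cmeasurable (fun x => f x * g x).
Proof.
move=> [mrf mif] [mrg mig]; split.
  rewrite [X in measurable_fun _ X](_ : _ =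
    (fun x => (@complex.Re R \o f) x * (@complex.Re R \o g) x
            - (@complex.Im R \o f) x * (@complex.Im R \o g) x)); last first.
    by apply/funext => x /=; case: (f x) (g x) => [a b] [c e].
  by apply: measurable_funB; exact: measurable_funM.
rewrite [X in measurable_fun _ X](_ : _ =
  (fun x => (@complex.Re R \o f) x * (@complex.Im R \o g) x
          + (@complex.Im R \o f) x * (@complex.Re R \o g) x)); last first.
  by apply/funext => x /=; case: (f x) (g x) => [a b] [c e].
by apply: measurable_funD; exact: measurable_funM.
Qed.

Lemma cmeasurable_conj f :
  cmeasurable f -> cmeasurable (fun x => (f x)^*).
Proof.
move=> [mr mi]; split.
  by rewrite (_ : _ \o _ = @complex.Re R \o f)//; apply/funext => x /=; case: (f x).
rewrite (_ : _ \o _ = \- (@complex.Im R \o f)); last first.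
  by apply/funext => x /=; case: (f x).
exact: measurableT_comp.
Qed.

Lemma measurable_sqmod f :
  cmeasurable f -> measurable_fun setT (fun x => (sqmod (f x))%:E).
Proof.
move=> [mr mi]; apply/measurable_EFinP; apply: measurable_funD.
  exact: (measurable_funX 2 mr).
exact: (measurable_funX 2 mi).
Qed.

Lemma sqmod_ge0 (z : R[i]) : 0 <= sqmod z.
Proof. by rewrite addr_ge0 ?sqr_ge0. Qed.

Lemma sqmodM (z w : R[i]) : sqmod (z * w) = sqmod z * sqmod w.
Proof. by case: z w => [a b] [c e]; rewrite /sqmod /=; ring. Qed.

Lemma sqmod_conj (z : R[i]) : sqmod z^* = sqmod z.
Proof. by case: z => a b; rewrite /sqmod /= sqrrN. Qed.

(** Turns the integrand of the Fourier-Wigner transform into the conjugate of a Fourier integrand,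
    whose phase has the opposite sign. *)
Lemma expi_mul_conj (t : R) (z w : R[i]) :
  expi t * z * w^* = (expi (- t) * (w * z^*))^*.
Proof.
case: z w => [a b] [c e]; apply/eqP; rewrite eq_complex /= cosN sinN.
by apply/andP; split; apply/eqP; ring.
Qed.

Lemma mul_conjC_sqmod (z : R[i]) : z * z^* = (sqmod z)%:C.
Proof.
by case: z => a b; apply/eqP; rewrite eq_complex /sqmod /=; apply/andP; split;
  apply/eqP; ring.
Qed.

(** With its companion for [Im], this dominates a product of two square-integrable functions by an
    integrable one. The squares of sums and differences give the bounds [2 |a c| <= a^2 + c^2] and
    the like. *)
Lemma normr_Re_mul (z w : R[i]) :
  `|complex.Re (z * w)| <= sqmod z + sqmod w.
Proof.
case: z w => [a b] [c e]; rewrite /sqmod /= ler_norml.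
have := sqr_ge0 (a - c); have := sqr_ge0 (a + c).
have := sqr_ge0 (b - e); have := sqr_ge0 (b + e).
by move=> *; apply/andP; split; nra.
Qed.

Lemma normr_Im_mul (z w : R[i]) :
  `|complex.Im (z * w)| <= sqmod z + sqmod w.
Proof.
case: z w => [a b] [c e]; rewrite /sqmod /= ler_norml.
have := sqr_ge0 (a - e); have := sqr_ge0 (a + e).
have := sqr_ge0 (b - c); have := sqr_ge0 (b + c).
by move=> *; apply/andP; split; nra.
Qed.

End ComplexMeasurable.

(** * Boxes, and the invariance of Lebesgue measures under reflection *)

Section Boxes.
Context {R : realType} {m n : nat}.
Implicit Types a b : 'M[R]_(m, n).

Definition box a b : set 'M[R]_(m, n) :=
  [set X | forall i j, a i j <= X i j <= b i j].

(** Corners are ordered because [is_lebesgue_measure] prescribes the measure of such boxes only; the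
    empty set makes the family stable under intersection. *)
Definition boxes : set (set 'M[R]_(m, n)) :=
  [set B | B = set0 \/
    exists2 p : 'M[R]_(m, n) * 'M[R]_(m, n),
      (forall i j, p.1 i j <= p.2 i j) & B = box p.1 p.2].

Lemma boxes_setI : setI_closed boxes.
Proof.
move=> A B [->|[[a b] /= ab ->]]; first by rewrite set0I; left.
move=> [->|[[c e] /= ce ->]]; first by rewrite setI0; left.
pose l := \matrix_(i, j) Num.max (a i j) (c i j).
pose u := \matrix_(i, j) Num.min (b i j) (e i j).
have -> : box a b `&` box c e = box l u.
  apply/seteqP; split=> [X [abX ceX] i j|X luX].
    rewrite !mxE ge_max le_min.
    by have /andP[-> ->] := abX i j; have /andP[-> ->] := ceX i j.
  by split=> i j; have := luX i j; rewrite !mxE ge_max le_min;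
    move=> /andP[/andP[? ?] /andP[? ?]]; apply/andP.
have [lu|lu] := pselect (forall i j, l i j <= u i j).
  by right; exists (l, u).
left; apply/seteqP; split=> // X luX; apply: lu => i j.
by have /andP[+ +] := luX i j; exact: le_trans.
Qed.

Lemma closed_box a b : closed (box a b).
Proof.
rewrite (_ : box a b = \bigcap_(p in [set: 'I_m * 'I_n])
    ((fun X : 'M[R]_(m, n) => X p.1 p.2) @^-1` `[a p.1 p.2, b p.1 p.2])).
  apply: closed_bigI => p _; apply: closed_comp; last exact: interval_closed.
  by move=> X _; exact: coord_continuous.
apply/seteqP; split=> [X abX [i j] _|X abX i j] /=.
  by rewrite in_itv; exact: abX.
by have := abX (i, j) I; rewrite /= in_itv.
Qed.

(** An open set is the union of the boxes with rational corners that it contains, and these are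
    countably many. Conversely a box is closed, hence Borel. *)
Lemma measurable_boxesE : @measurable _ (borel 'M[R]_(m, n)) = <<s boxes >>.
Proof.
apply/seteqP; split.
  apply: smallest_sub; first exact: smallest_sigma_algebra.
  move=> U oU.
  pose M q : 'M[R]_(m, n) := map_mx ratr (q : 'M[rat]_(m, n)).
  pose D := [set p | (forall i j, M p.1 i j <= M p.2 i j) /\
                     box (M p.1) (M p.2) `<=` U].
  have -> : U = \bigcup_(p in D) box (M p.1) (M p.2).
    apply/seteqP; split=> [X UX|X [p [_ pU] /pU]//].
    have /nbhs_ballP [e /= e0 XeU] := open_nbhs_nbhs (conj oU UX).
    (* Rational corners strictly on either side of each entry of [X] and within [e] of it: the box
       contains [X] and stays in the ball of radius [e], balls being defined entrywise. *)
    have Hl i j : exists q : rat, ratr q \in `]X i j - e, X i j[.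
      by apply: rat_in_itvoo; rewrite ltrBlDr ltrDl.
    have Hu i j : exists q : rat, ratr q \in `]X i j, X i j + e[.
      by apply: rat_in_itvoo; rewrite ltrDl.
    pose l := \matrix_(i < m, j < n) projT1 (cid (Hl i j)).
    pose u := \matrix_(i < m, j < n) projT1 (cid (Hu i j)).
    have lP i j : X i j - e < M l i j < X i j.
      by rewrite !mxE; case: cid => q /=; rewrite in_itv.
    have uP i j : X i j < M u i j < X i j + e.
      by rewrite !mxE; case: cid => q /=; rewrite in_itv.
    exists (l, u); last first.
      by move=> i j /=; have := lP i j; have := uP i j; lra.
    split=> [i j|Y luY] /=; first by have := lP i j; have := uP i j; lra.
    apply: XeU; split=> // i j; rewrite /ball /= ltr_norml.
    by have := luY i j => /=; have := lP i j; have := uP i j; lra.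
  apply: (@bigcup_countable_measurable _ (g_sigma_algebraType boxes)).
    exact: countableP.
  by move=> p [pp _]; apply: sub_sigma_algebra; right; exists (M p.1, M p.2).
apply: smallest_sub; first exact: smallest_sigma_algebra.
move=> B [->|[p _ ->]]; first exact: (@measurable0 _ (borel 'M[R]_(m, n))).
rewrite -[box _ _]setCK; apply: (@measurableC _ (borel 'M[R]_(m, n))).
by apply: sub_sigma_algebra; apply: closed_openC; exact: closed_box.
Qed.

(** Reflection sends the box with corners [a], [b] to the one with corners [- b], [- a], of the same
    volume. Two measures that agree on the generating, intersection-stable family of boxes are
    equal. *)
Lemma lebesgue_measure_opp
    (mu : {measure set (borel 'M[R]_(m, n)) -> \bar R}) :
  is_lebesgue_measure mu ->
  forall B : set (borel 'M[R]_(m, n)), measurable B ->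
    mu B = pushforward mu
      ((fun X => - X) : borel 'M[R]_(m, n) -> borel 'M[R]_(m, n)) B.
Proof.
move=> [c c0 muE] B mB.
pose opp' : borel 'M[R]_(m, n) -> borel 'M[R]_(m, n) := fun X => - X.
rewrite -/opp'.
have mopp : measurable_fun setT opp'.
  by apply: continuous_borel; exact: opp_continuous.
(* Cubes of finite measure exhausting the space, for the uniqueness theorem. *)
pose g k := box (const_mx (- k%:R)) (const_mx k%:R).
have gle k i j : (const_mx (- k%:R) : 'M[R]_(m, n)) i j
    <= (const_mx k%:R : 'M[R]_(m, n)) i j.
  by rewrite !mxE ge0_cp// ler0n.
pose nu : {measure set (borel 'M[R]_(m, n)) -> \bar R} := pushforward mu opp'.
change (mu B = nu mopp B).
refine (@measure_unique _ R (borel 'M[R]_(m, n)) boxes g _ _ _ _ mu (nu mopp) _ _ B mB).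
- exact: measurable_boxesE.
- exact: boxes_setI.
- by move=> k; right; exists (const_mx (- k%:R), const_mx k%:R) => //; exact: gle.
- apply/seteqP; split=> // X _.
  exists (\max_(p : 'I_m * 'I_n) Num.bound `|X p.1 p.2|) => // i j.
  rewrite !mxE -ler_norml (le_trans (ltW (archi_boundP _)))// ler_nat.
  exact: (leq_bigmax (i, j)).
- move=> A [->|[[a b] /= ab ->]]; first by rewrite !measure0.
  change (mu (box a b) = mu (opp' @^-1` box a b)).
  have -> : opp' @^-1` box a b = box (- b) (- a).
    apply/seteqP; split=> X abX i j; have := abX i j; rewrite /opp' !mxE; lra.
  rewrite muE// muE; last by move=> i j; rewrite !mxE lerN2.
  congr (_ * _)%:E; apply: eq_bigr => i _; apply: eq_bigr => j _.
  by rewrite !mxE; ring.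
- by move=> k; rewrite muE; [exact: ltry|exact: gle].
Qed.

End Boxes.

(** * Square-integrable functions, their classes and scalar products *)

Section SquareIntegrable.
Context {R : realType} {d : measure_display} {T : measurableType d}.
Variable mu : {measure set T -> \bar R}.
Implicit Types f g : T -> R[i].

Lemma cintegrable_mul f g : square_integrable mu f -> square_integrable mu g ->
  cintegrable mu (fun x => f x * g x).
Proof.
move=> [mf foo] [mg goo].
have [mre mim] := cmeasurableM mf mg.
have isq h : cmeasurable h -> (\int[mu]_x (sqmod (h x))%:E < +oo)%E ->
    mu.-integrable setT (fun x => (sqmod (h x))%:E).
  move=> mh hoo; apply/integrableP; split; first exact: measurable_sqmod.
  by under eq_integral do rewrite gee0_abs ?lee_fin ?sqmod_ge0//.
have ifg : mu.-integrable setT (fun x => (sqmod (f x))%:E + (sqmod (g x))%:E)%E.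
  by apply: integrableD => //; exact: isq.
have nn x : 0 <= sqmod (f x) + sqmod (g x).
  exact: addr_ge0 (sqmod_ge0 _) (sqmod_ge0 _).
split; apply: (le_integrable _ _ _ ifg) => //; try exact/measurable_EFinP.
  move=> x _ /=; rewrite lee_fin [leRHS]ger0_norm ?nn//.
  exact: normr_Re_mul.
move=> x _ /=; rewrite lee_fin [leRHS]ger0_norm ?nn//.
exact: normr_Im_mul.
Qed.

Lemma square_integrable_conj f :
  square_integrable mu f -> square_integrable mu (fun x => (f x)^*).
Proof.
move=> [mf foo]; split; first exact: cmeasurable_conj.
by under eq_integral do rewrite sqmod_conj.
Qed.

Lemma square_integrable_mul_bounded f g :
  essentially_bounded mu f -> square_integrable mu g ->
  square_integrable mu (fun x => f x * g x).
Proof.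
move=> [mf [M fM]] [mg goo]; split; first exact: cmeasurableM.
have mg' := measurable_sqmod mg.
apply: (@le_lt_trans _ _ (\int[mu]_x ((M ^+ 2)%:E * (sqmod (g x))%:E))%E).
  apply: ae_ge0_le_integral => //.
  - by move=> x _; rewrite lee_fin sqmod_ge0.
  - by apply: measurable_sqmod; exact: cmeasurableM.
  - by move=> x _; rewrite mule_ge0 ?lee_fin ?sqr_ge0 ?sqmod_ge0.
  - exact: measurable_funeM.
  - apply: filterS fM => x fM _; rewrite sqmodM lee_fin.
    by rewrite ler_wpM2r ?sqmod_ge0.
rewrite ge0_integralZl_EFin ?sqr_ge0//; last first.
  by move=> x _; rewrite lee_fin sqmod_ge0.
by rewrite lte_mul_pinfty ?lee_fin ?sqr_ge0.
Qed.

Lemma L2_val_square_integrable (u : L2 mu) : square_integrable mu u.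
Proof. by rewrite /L2_val; case: (repr u). Qed.

(** The function underlying a class is an arbitrary representative, so it is known only up to a null
    set. *)
Lemma L2_classE f : square_integrable mu f ->
  {ae mu, forall x, L2_class mu f x = f x}.
Proof.
move=> hf; rewrite /L2_class; case: pselect => // hf'.
set g := L2Fun hf'.
have /eqmodP/asboolP : repr (\pi_(L2 mu)%qT g) = g %[mod L2 mu]%qT by rewrite reprK.
by apply: filterS.
Qed.

(** Holds for every [f]: when the positive or the negative part has infinite integral, [fine] makes
    both sides 0. Conjugate symmetry of [inner] thereby holds for all functions. *)
Lemma RintegralN (f : T -> R) : \int[mu]_x (- f x) = - \int[mu]_x f x.
Proof.
rewrite /Rintegral integralE [in RHS]integralE.
rewrite (_ : (fun x => (- f x)%:E) = (\- (EFin \o f))%E)//.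
rewrite funeposN funenegN -[EFin \o f]/(fun x => (f x)%:E).
set a := (\int[mu]_x (_^\-)%E x)%E; set b := (\int[mu]_x _)%E.
have : (0 <= a)%E by apply: integral_ge0 => x _; exact: funeneg_ge0.
have : (0 <= b)%E by apply: integral_ge0 => x _; exact: funepos_ge0.
by case: a b => [a||] [b||] //= _ _; rewrite ?oppr0// opprB.
Qed.

Lemma cintegral_conj f : cintegral mu (fun x => (f x)^*) = (cintegral mu f)^*.
Proof.
rewrite /cintegral /= -RintegralN; congr (_ +i* _).
  by apply: eq_Rintegral => x _ /=; case: (f x).
by apply: eq_Rintegral => x _ /=; case: (f x).
Qed.

Lemma inner_conj f g : inner mu f g = (inner mu g f)^*.
Proof.
rewrite /inner -cintegral_conj; congr cintegral; apply/funext => x.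
by case: (f x) (g x) => [a b] [c e]; apply/eqP; rewrite eq_complex /=;
  apply/andP; split; apply/eqP; ring.
Qed.

Lemma inner_self f :
  inner mu f f = (fine (\int[mu]_x (sqmod (f x))%:E)%E)%:C.
Proof.
rewrite /inner /cintegral; under eq_Rintegral do rewrite mul_conjC_sqmod /=.
congr (_ +i* _); rewrite /Rintegral integral0_eq// => x _.
by rewrite mul_conjC_sqmod.
Qed.

Lemma cintegral_ae f g : cmeasurable f -> cmeasurable g ->
  {ae mu, forall x, f x = g x} -> cintegral mu f = cintegral mu g.
Proof.
move=> [mrf mif] [mrg mig] fg; rewrite /cintegral; congr (_ +i* _); congr fine.
  apply: ae_eq_integral => //; [exact/measurable_EFinP|exact/measurable_EFinP|].
  by apply: filterS fg => x + _ => ->.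
apply: ae_eq_integral => //; [exact/measurable_EFinP|exact/measurable_EFinP|].
by apply: filterS fg => x + _ => ->.
Qed.

End SquareIntegrable.

(** * Complex change of variables and integrals depending on a parameter *)

Section Preserved.
Context {d1 d2 : measure_display} {T1 : measurableType d1}
  {T2 : measurableType d2} {R : realType}.
Context (mu : {measure set T1 -> \bar R}) (nu : {measure set T2 -> \bar R}).
Context (phi : T1 -> T2) (mphi : measurable_fun setT phi).
Hypothesis nuE : forall B, measurable B -> nu B = pushforward mu phi B.

Lemma cintegral_preserved (f : T2 -> R[i]) : cmeasurable f ->
  cintegral nu f = cintegral mu (f \o phi).
Proof.
by move=> [mr mi]; congr (_ +i* _); apply: (Rintegral_preserved mphi nuE).
Qed.

Lemma square_integrable_preserved (f : T2 -> R[i]) :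
  square_integrable nu f -> square_integrable mu (f \o phi).
Proof.
move=> [mf]; rewrite (integral_preserved mphi nuE); last exact: measurable_sqmod.
by move=> foo; split => //; exact: cmeasurable_comp mf mphi.
Qed.

End Preserved.

(** Tonelli gives measurability of the partial integrals of the positive and negative parts; their
    difference and [fine] preserve it. *)
Lemma measurable_Rintegral {d1 d2 : measure_display} {T1 : measurableType d1}
    {T2 : measurableType d2} {R : realType}
    (m2 : {sigma_finite_measure set T2 -> \bar R}) (h : T1 * T2 -> R) :
  measurable_fun setT h -> measurable_fun setT (fun x => \int[m2]_y h (x, y)).
Proof.
move=> mh; apply: measurableT_comp => //.
have mE : measurable_fun setT (EFin \o h) by exact/measurable_EFinP.
rewrite [X in measurable_fun _ X](_ : _ =
    (fubini_F m2 (EFin \o h)^\+ \- fubini_F m2 (EFin \o h)^\-)%E).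
  by apply: emeasurable_funB; apply: measurable_fun_fubini_tonelli_F => //;
    [exact: measurable_funepos|exact: measurable_funeneg].
apply/funext => x; rewrite integralE /fubini_F.
rewrite (funepos_comp (EFin \o h) (pair x)) //.
by rewrite (funeneg_comp (EFin \o h) (pair x)).
Qed.

(** * Translations of the group and inversion under [exp] *)

Section Translations.
Context {R : realType} {G : ptopGroupType}.
Hypotheses (mul_cont : continuous (fun p : G * G => (p.1 * p.2)%g : G))
  (inv_cont : continuous (fun x : G => (x^-1)%g : G)).

Lemma continuous_mulg_inv : continuous (fun p : G * G => (p.1^-1 * p.2)%g : G).
Proof.
move=> p.
apply: (@continuous_comp _ _ _ (fun q : G * G => (q.1^-1, q.2)%g)
  (fun q : G * G => (q.1 * q.2)%g) p); last exact: mul_cont.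
apply: (@cvg_pair _ _ _ _ (nbhs (p.1^-1)%g) (nbhs p.2)); last exact: cvg_snd.
apply: (@continuous_comp _ _ _ fst (fun x : G => (x^-1)%g) p).
  exact: cvg_fst.
exact: inv_cont.
Qed.

Lemma measurable_mulg (z : G) :
  measurable_fun setT ((fun x => (z * x)%g) : borel G -> borel G).
Proof.
apply: continuous_borel => x.
apply: (@continuous_comp _ _ _ (fun y : G => (z, y))
  (fun q : G * G => (q.1 * q.2)%g) x); last exact: mul_cont.
by apply: cvg_pair => /=; [exact: cvg_cst|exact: cvg_id].
Qed.

(** The preimage of [B] under multiplication by [z] is its image under multiplication by [z^-1].
    This is left invariance in the form that the change of variables requires. *)
Lemma haar_mulg (dx : {measure set (borel G) -> \bar R}) (z : G) :
  is_haar_measure dx -> forall B : set (borel G), measurable B ->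
  dx B = pushforward dx ((fun x => (z * x)%g) : borel G -> borel G) B.
Proof.
move=> hdx B mB; rewrite -(haar_left_invariant hdx (z^-1)%g mB); congr (dx _).
apply/seteqP; split=> [_ [x Bx <-]|x /= Bx].
  by rewrite /= mulVKg.
by exists (z * x)%g => //; rewrite mulKg.
Qed.

End Translations.

(** The element [exp 0] equals its own square, hence is 1; then [exp X * exp (- X) = exp 0] by the
    one-parameter law at times 1 and -1. *)
Lemma exp_opp {R : realType} {n : nat} {G : ptopGroupType}
    (A : set (chart R n G)) (exp : 'rV[R]_n -> G) :
  is_exponential_map A exp -> forall X, exp (- X) = (exp X)^-1%g.
Proof.
move=> [e1 _] X.
have e0 : exp 0 = 1%g.
  have := e1 0 0 0; rewrite !scaler0 => h.
  by apply: (@mulgI _ (exp 0)); rewrite mulg1 -h.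
apply: (@mulgI _ (exp X)); rewrite mulgV -e0.
by have := e1 X 1 (-1); rewrite addrN scale0r scale1r scaleN1r => ->.
Qed.

(** * Plancherel formula *)

Section Plancherel.
Context {R : realType} {n : nat}.
Context (dX : {measure set (borel 'rV[R]_n) -> \bar R})
  (dxi : {measure set (borel 'cV[R]_n) -> \bar R}).

(** Unitarity, applied to the class of [h] paired with itself, equates the [fine] values of the two
    integrals. Both are finite by square integrability, so they agree as extended reals. *)
Lemma fourier_plancherel (h : borel 'rV[R]_n -> R[i]) :
  fourier_normalized dX dxi -> cintegrable dX h -> square_integrable dX h ->
  (\int[dxi]_xi (sqmod (fourier dX h xi))%:E = \int[dX]_X (sqmod (h X))%:E)%E.
Proof.
move=> [U [Uinner _] UE] ih sh; have [sF UhE] := UE h ih sh.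
have := Uinner (L2_class dX h) (L2_class dX h); rewrite UhE.
have classE d (T : measurableType d) (mu : {measure set T -> \bar R}) k :
    square_integrable mu k ->
    inner mu (L2_class mu k) (L2_class mu k) =
    (fine (\int[mu]_x (sqmod (k x))%:E)%E)%:C.
  move=> sk; rewrite -inner_self; apply: cintegral_ae.
  - have [m _] := L2_val_square_integrable (L2_class mu k).
    by apply: cmeasurableM => //; exact: cmeasurable_conj.
  - have [m _] := sk.
    by apply: cmeasurableM => //; exact: cmeasurable_conj.
  - by apply: filterS (L2_classE sk) => x ->.
rewrite (classE _ _ _ _ sF) (classE _ _ _ _ sh).
have fin d (T : measurableType d) (mu : {measure set T -> \bar R}) k :
    square_integrable mu k -> (\int[mu]_x (sqmod (k x))%:E)%E \is a fin_num.
  move=> [_ koo]; rewrite ge0_fin_numE// integral_ge0// => x _.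
  by rewrite lee_fin sqmod_ge0.
by move/(congr1 (EFin \o @complex.Re R)); rewrite /= !fineK ?fin.
Qed.

End Plancherel.

(** * Schwartz functions and the duality pairing *)

Lemma real_schwartz_continuous {R : realType} {V : normedModType R}
    (g : V -> R^o) : real_schwartz g -> continuous g.
Proof. by move=> [sg _] x; have [] := sg [::] x I. Qed.

Lemma schwartz_sqmod_bounded {R : realType} {V : normedModType R}
    (g : V -> R[i]) :
  schwartz g -> exists M : R, forall x, sqmod (g x) <= M ^+ 2.
Proof.
(* The decay estimate with weight exponent 0 and no derivative is a plain bound; [M1 + M2] works
   because [a^2 + b^2 <= (|a| + |b|)^2]. *)
move=> [[_ /(_ 0 [::]) [M1 gM1]] [_ /(_ 0 [::]) [M2 gM2]]].
exists (M1 + M2) => x; have := gM1 x; have := gM2 x.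
rewrite /= !expr0 !mul1r /sqmod => h2 h1.
have n1 := normr_ge0 (complex.Re (g x)); have n2 := normr_ge0 (complex.Im (g x)).
rewrite -[complex.Re (g x) ^+ 2]real_normK ?num_real//.
rewrite -[complex.Im (g x) ^+ 2]real_normK ?num_real//.
nra.
Qed.

Lemma measurable_pairing {R : realType} {n : nat} :
  measurable_fun setT (fun q : borel 'rV[R]_n * borel 'cV[R]_n =>
    pairing q.1 q.2).
Proof.
rewrite [X in measurable_fun _ X](_ : _ =
    (fun q => \sum_(k < n) (q.1 : 'rV[R]_n) ord0 k * (q.2 : 'cV[R]_n) k ord0));
  last by apply/funext => q; rewrite /pairing mxE.
apply: measurable_sum => k; apply: measurable_funM.
- have m := continuous_borel_real (@coord_continuous R 1 n ord0 k).
  exact: (measurableT_comp m measurable_fst).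
- have m := continuous_borel_real (@coord_continuous R n 1 k ord0).
  exact: (measurableT_comp m measurable_snd).
Qed.

(** * Square integrability of the Fourier-Wigner transform *)

Section FourierWigner.
Context {R : realType} {n : nat} {G : ptopGroupType}.
Context {A : set (chart R n G)} {exp : 'rV[R]_n -> G} {log : G -> 'rV[R]_n}.
Context {dX : {sigma_finite_measure set (borel 'rV[R]_n) -> \bar R}}
  {dx : {sigma_finite_measure set (borel G) -> \bar R}}
  {dxi : {sigma_finite_measure set (borel 'cV[R]_n) -> \bar R}}.
Hypotheses (hG : is_lie_group A) (hexp : is_exponential_map A exp)
  (hdiffeo : is_diffeomorphism A exp log)
  (hdX : is_lebesgue_measure dX) (hdx : is_haar_measure dx)
  (hdx_image : forall B : set (borel G),
     measurable B -> dx B = pushforward dX (exp : borel 'rV[R]_n -> borel G) B)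
  (hdxi_norm : fourier_normalized dX dxi).

Let mexp : measurable_fun setT (exp : borel 'rV[R]_n -> borel G).
Proof. by apply: continuous_borel; exact: diffeo_exp_cont hdiffeo. Qed.

Let mlog : measurable_fun setT (log : borel G -> borel 'rV[R]_n).
Proof. by apply: continuous_borel; exact: diffeo_log_cont hdiffeo. Qed.

Let minv : measurable_fun setT ((fun x => (x^-1)%g) : borel G -> borel G).
Proof. by apply: continuous_borel; exact: lie_inv_cont hG. Qed.

Let mdiv : measurable_fun setT
  ((fun p => (p.1^-1 * p.2)%g) : borel G * borel G -> borel G).
Proof.
exact: (continuous_borel_prod (lie_second_countable hG)
  (lie_second_countable hG)
  (continuous_mulg_inv (lie_mul_cont hG) (lie_inv_cont hG))).
Qed.

Let mdivr (x : G) :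
  measurable_fun setT ((fun z => (z^-1 * x)%g) : borel G -> borel G).
Proof.
exact: (measurableT_comp mdiv
  (@pair2_measurable _ _ (borel G) (borel G) x)).
Qed.

(** This plays the part of unimodularity: pulled back along [exp], inversion becomes a reflection,
    which preserves [dX]. *)
Lemma haar_invg (B : set (borel G)) : measurable B ->
  dx B = pushforward dx ((fun x => (x^-1)%g) : borel G -> borel G) B.
Proof.
move=> mB; rewrite hdx_image//.
have mB' : measurable ((exp : borel 'rV[R]_n -> borel G) @^-1` B).
  by rewrite -[X in measurable X]setTI; exact: mexp.
have mB2 : measurable (((fun x => (x^-1)%g) : borel G -> borel G) @^-1` B).
  by rewrite -[X in measurable X]setTI; exact: minv.
rewrite /pushforward (hdx_image mB2) (lebesgue_measure_opp hdX mB').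
by congr (dX _); apply/seteqP; split=> X /=; rewrite (exp_opp hexp).
Qed.

(* Left invariance reduces this to inversion invariance, by z |-> x z. *)
Lemma haar_integral_invgM (x : G) (h : G -> \bar R) :
  measurable_fun setT (h : borel G -> \bar R) ->
  (\int[dx]_z h (z^-1 * x)%g = \int[dx]_z h z)%E.
Proof.
move=> mh; have mx := measurable_mulg (lie_mul_cont hG) x.
rewrite [RHS](integral_preserved minv haar_invg mh).
rewrite (integral_preserved mx (@haar_mulg _ _ dx x hdx)).
  by apply: eq_integral => z _; rewrite invgM -mulgA mulVg mulg1.
exact: (measurableT_comp mh (mdivr x)).
Qed.

Variable omega : G -> R[i].
Hypotheses (homega : schwartz (omega \o exp)) (homega1 : l2norm dx omega = 1).

Lemma omega_measurable : cmeasurable (omega : borel G -> R[i]).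
Proof.
have [hr hi] := homega.
have E : omega = (omega \o exp) \o log.
  by apply/funext => x /=; rewrite (diffeo_logK hdiffeo).
rewrite E; apply: cmeasurable_comp mlog; split.
  exact: continuous_borel_real (real_schwartz_continuous hr).
exact: continuous_borel_real (real_schwartz_continuous hi).
Qed.

Lemma omega_bounded : essentially_bounded dx omega.
Proof.
split; first exact: omega_measurable.
have [M oM] := schwartz_sqmod_bounded homega; exists M.
by apply: aeW => x; rewrite -(diffeo_logK hdiffeo x); exact: oM.
Qed.

(** Finiteness is read off the normalization: an infinite integral would have [fine] value 0, making
    [l2norm] equal to 0 instead of 1. *)
Lemma omega_square_integrable : square_integrable dx omega.
Proof.
split; first exact: omega_measurable.
have : l2norm dx omega != 0 by rewrite homega1 oner_neq0.
rewrite /l2norm /Rintegral; case: (\int[dx]_x _)%E => [r _||] //=.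
- exact: ltry.
- by rewrite sqrtr0 eqxx.
Qed.

Variable u : L2 dx.

Let u_translate (z : G) : square_integrable dx (fun x => u (z^-1 * x)%g).
Proof.
exact: (square_integrable_preserved (measurable_mulg (lie_mul_cont hG) z^-1%g)
  (@haar_mulg _ _ dx z^-1%g hdx) (L2_val_square_integrable u)).
Qed.

(** Integrand of the transform at [z], stripped of its phase and conjugated so that the remaining
    phase has the sign of [fourier]. *)
Let slice (z : G) (x : G) : R[i] := omega x * (u (z^-1 * x)%g)^*.

(** Plancherel is available on the intersection of L^1 and L^2. Membership in L^2 comes from the
    boundedness of [omega]; membership in L^1, shown next, from [omega] and the translate of [u]
    both being in L^2. *)
Let slice_square_integrable z : square_integrable dx (slice z).
Proof.
apply: square_integrable_mul_bounded; first exact: omega_bounded.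
exact: square_integrable_conj.
Qed.

Let slice_exp_integrable z :
  cintegrable dX (slice z \o exp : borel 'rV[R]_n -> R[i]).
Proof.
apply: cintegrable_mul.
  exact: (square_integrable_preserved mexp hdx_image omega_square_integrable).
apply: square_integrable_conj.
exact: (square_integrable_preserved mexp hdx_image (u_translate z)).
Qed.

Let kernel (q : borel G * borel 'cV[R]_n * borel G) : R[i] :=
  weyl log q.1 u q.2 * (omega q.2)^*.

(** Joint measurability in the three variables lets the integral over [x] be measurable in the other
    two. The delicate factor is [u (z^-1 * x)]: it rests on [mdiv], hence on second countability of
    [G]. *)
Let kernel_measurable : cmeasurable kernel.
Proof.
have mlogxi : measurable_fun setT
    (fun q : borel G * borel 'cV[R]_n * borel G =>
      (log q.2 : borel 'rV[R]_n, q.1.2)).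
  apply: measurable_fun_pair.
    exact: (measurableT_comp mlog measurable_snd).
  exact: (measurableT_comp measurable_snd measurable_fst).
have mzx : measurable_fun setT
    (fun q : borel G * borel 'cV[R]_n * borel G => (q.1.1, q.2)).
  apply: measurable_fun_pair; last exact: measurable_snd.
  exact: (measurableT_comp measurable_fst measurable_fst).
have mp := measurableT_comp measurable_pairing mlogxi.
have [mu' _] := L2_val_square_integrable u.
apply: cmeasurableM; last first.
  apply: cmeasurable_conj.
  exact: cmeasurable_comp omega_measurable measurable_snd.
apply: cmeasurableM; last first.
  exact: cmeasurable_comp mu' (measurableT_comp mdiv mzx).
split.
  have mcos := continuous_measurable_fun (@continuous_cos R).
  exact: (measurableT_comp mcos mp).
have msin := continuous_measurable_fun (@continuous_sin R).
exact: (measurableT_comp msin mp).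
Qed.

Lemma fourier_wigner_slice z xi :
  fourier_wigner log dx u omega (z, xi) = (fourier dX (slice z \o exp) xi)^*.
Proof.
have mker := cmeasurable_comp kernel_measurable
  (@pair1_measurable _ _ (borel G * borel 'cV[R]_n)%type (borel G) (z, xi)).
rewrite /fourier -cintegral_conj.
rewrite [LHS](cintegral_preserved mexp hdx_image mker); congr cintegral.
apply/funext => X; rewrite /kernel /slice /weyl /= (diffeo_expK hdiffeo).
exact: expi_mul_conj.
Qed.

Lemma fourier_wigner_measurable :
  cmeasurable (fourier_wigner log dx u omega : borel G * borel 'cV[R]_n -> R[i]).
Proof.
have [mr mi] := kernel_measurable.
split; [exact: (measurable_Rintegral dx mr)|exact: (measurable_Rintegral dx mi)].
Qed.

Lemma fourier_wigner_square_integrable :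
  square_integrable (dXi dx dxi) (fourier_wigner log dx u omega).
Proof.
split; first exact: fourier_wigner_measurable.
have [mu' uoo] := L2_val_square_integrable u.
have [mo ooo] := omega_square_integrable.
have mW := measurable_sqmod fourier_wigner_measurable.
(* Plancherel in the momentum variable, for each z, then Tonelli in (z, x). *)
rewrite /dXi fubini_tonelli1//; last by move=> p; rewrite lee_fin sqmod_ge0.
pose k := fun p : borel G * borel G =>
  ((sqmod (omega p.2))%:E * (sqmod (u (p.1^-1 * p.2)%g))%:E)%E.
rewrite (eq_integral (fun z => \int[dx]_x k (z, x))%E); last first.
  move=> z _; rewrite /fubini_F.
  under eq_integral do rewrite fourier_wigner_slice sqmod_conj.
  rewrite (fourier_plancherel hdxi_norm (slice_exp_integrable z)); last first.
    exact: (square_integrable_preserved mexp hdx_image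
      (slice_square_integrable z)).
  rewrite -(integral_preserved mexp hdx_image
    (g := fun x => (sqmod (slice z x))%:E)).
    by apply: eq_integral => x _; rewrite sqmodM sqmod_conj EFinM.
  by apply: measurable_sqmod; exact: (slice_square_integrable z).1.
have mk : measurable_fun setT k.
  apply: emeasurable_funM.
    exact: (measurableT_comp (measurable_sqmod mo) measurable_snd).
  exact: (measurableT_comp (measurable_sqmod mu') mdiv).
(* The order is exchanged so that [z] is integrated first: for fixed [x] the inner integral is
   [sqmod (omega x)] times the squared norm of [u], and [u] separates from [omega]. *)
rewrite fubini_tonelli//; last first.
  by move=> p; rewrite mule_ge0 ?lee_fin ?sqmod_ge0.
under eq_integral => x _.
  rewrite /k /= ge0_integralZl_EFin ?sqmod_ge0//;
    [|by move=> *; rewrite lee_fin sqmod_ge0|]; last first.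
    exact: (measurableT_comp (measurable_sqmod mu') (mdivr x)).
  rewrite (haar_integral_invgM x (measurable_sqmod mu')).
  over.
rewrite ge0_integralZr//=.
- rewrite lte_mul_pinfty// ?integral_ge0// => [x _|];
    rewrite ?lee_fin ?sqmod_ge0// ge0_fin_numE// integral_ge0// => x _.
  by rewrite lee_fin sqmod_ge0.
- exact: measurable_sqmod mo.
- by move=> x _; rewrite lee_fin sqmod_ge0.
- by apply: integral_ge0 => x _; rewrite lee_fin sqmod_ge0.
Qed.

End FourierWigner.

(** * The Toeplitz operator as a compressed multiplication *)

Theorem proposition4p8 (R : realType) (n : nat)
    (G : ptopGroupType) (A : set (chart R n G))
    (hG : is_lie_group A)
    (hconn : connected [set: G])
    (hsimply : simply_connected G R)
    (hnilp : nilpotent_group G)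
    (exp : 'rV[R]_n -> G) (log : G -> 'rV[R]_n)
    (br : 'rV[R]_n -> 'rV[R]_n -> 'rV[R]_n)
    (hexp : is_exponential_map A exp)
    (hdiffeo : is_diffeomorphism A exp log)
    (hbr : is_lie_bracket exp log br)
    (dX : {sigma_finite_measure set (borel 'rV[R]_n) -> \bar R})
    (dx : {sigma_finite_measure set (borel G) -> \bar R})
    (dxi : {sigma_finite_measure set (borel 'cV[R]_n) -> \bar R})
    (hdX : is_lebesgue_measure dX)
    (hdx : is_haar_measure dx)
    (hdx_image : forall B : set (borel G),
       measurable B -> dx B = pushforward dX (exp : borel 'rV[R]_n -> borel G) B)
    (hdxi : is_lebesgue_measure dxi)
    (hdxi_norm : fourier_normalized dX dxi)
    (omega : G -> R[i])
    (homega : schwartz (omega \o exp))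
    (homega1 : l2norm dx omega = 1)
    (f : G * 'cV[R]_n -> R[i])
    (hf : essentially_bounded (dXi dx dxi) f) :
  toeplitz log omega f =
  bargmann_proj log omega \o mult_op (mu := dXi dx dxi) f
    \o bargmann_proj log omega.
Proof.
pose W (u : L2 dx) : borel G * borel 'cV[R]_n -> R[i] :=
  fourier_wigner log dx u omega.
have W2 u : square_integrable (dXi dx dxi) (W u).
  exact: (fourier_wigner_square_integrable hG hexp hdiffeo hdX hdx hdx_image
    hdxi_norm homega homega1 u).
pose B := bargmann log dxi omega : L2 dx -> L2 (dXi dx dxi).
have BE u : {ae dXi dx dxi, forall p, B u p = W u p} by exact: (L2_classE (W2 u)).
have mL2 (F : L2 (dXi dx dxi)) : cmeasurable F.
  by case: (L2_val_square_integrable F).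
have mW u : cmeasurable (W u) by case: (W2 u).
suff BerE u : berezin log dxi omega f u =
    adjoint B (mult_op (mu := dXi dx dxi) f (B u)).
  by apply/funext => F; rewrite /toeplitz /bargmann_proj /= BerE.
(* Both sides are chosen from the same set of vectors: the two weak conditions
   are complex conjugates of each other. *)
rewrite /berezin /adjoint; congr xget; apply/seteqP.
have formE v : inner (dXi dx dxi) (B v) (mult_op (mu := dXi dx dxi) f (B u)) =
    (cintegral (dXi dx dxi) (fun p => f p * W u p * (W v p)^*))^*.
  have [mf _] := hf.
  (* This ensures that [mult_op] yields the class of the product and not the default value zero of
     [L2_class]. *)
  have fB2 : square_integrable (dXi dx dxi) (fun p => f p * B u p).
    apply: square_integrable_mul_bounded => //; exact: L2_val_square_integrable.
  (* The chosen representatives of [B u], [B v] and of the product are replaced under the integral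
     by [W u], [W v] and [f * W u], to which they are equal almost everywhere. *)
  rewrite inner_conj; congr (_^*); apply: cintegral_ae.
  - by apply: cmeasurableM; [exact: mL2|exact/cmeasurable_conj/mL2].
  - by apply: cmeasurableM; [exact: cmeasurableM|exact: cmeasurable_conj].
  - apply: filterS3 (BE u) (BE v) (L2_classE fB2) => p uE vE fE.
    by rewrite /mult_op fE uE vE.
split=> w wE v.
  by rewrite inner_conj wE formE.
by rewrite inner_conj wE formE conjcK.
Qed.
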